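(* For every $n\ge 1$ there is a bijection between the set $\mathcal{DU}_{2n-1}(4123)$ and the set of shifted standard Young tableaux of shape $(n+1,n,n-1)$ such that, for every $\pi=\pi_1\pi_2\ldots\pi_{2n-1}\in\mathcal{DU}_{2n-1}(4123)$, the $(1,n+1)$-entry of the tableau corresponding to $\pi$ is equal to $3n-\pi_1$.
   Context: A permutation $\pi=\pi_1\cdots\pi_m$ of $[m]=\{1,\ldots,m\}$ is down-up alternating if $\pi_1>\pi_2<\pi_3>\pi_4<\cdots$; it avoids the pattern $4123$ if no subsequence $\pi_{i_1}\pi_{i_2}\pi_{i_3}\pi_{i_4}$ ($i_1<i_2<i_3<i_4$) satisfies $\pi_{i_2}<\pi_{i_3}<\pi_{i_4}<\pi_{i_1}$. $\mathcal{DU}_m(4123)$ is the set of $4123$-avoiding down-up alternating permutations of $[m]$. For a partition $\lambda=(\lambda_1>\lambda_2>\cdots)$ with distinct parts, the shifted Young diagram of shape $\lambda$ has $\lambda_i$ cells in row $i$, each row indented one cell to the right relative to the previous row (so row $i$ occupies columns $i,\ldots,i+\lambda_i-1$; a part equal to $0$ gives an empty row). A shifted standard Young tableau is a filling of this diagram with $1,\ldots,|\lambda|$, each used once, increasing along rows and down columns. The $(i,j)$-entry is the entry in row $i$, column $j$. *)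

(* Defs.v *)
From mathcomp Require Import all_boot all_fingroup.

Set Implicit Arguments.
Unset Strict Implicit.
Unset Printing Implicit Defensive.

(* A permutation of [m] is an element of 'S_m, hence indexed from 0: its k-th
   letter, in the 1-based convention, is one more than the image of k - 1.
   The value is 0, which is not a letter, unless 1 <= k <= m. *)
Definition letter (m : nat) (pi : 'S_m) (k : nat) : nat :=
  if [pick i : 'I_m | i.+1 == k] is Some i then (pi i).+1 else 0.

(* With 0-based positions the descents are at the even i. *)
Definition down_up (m : nat) (pi : 'S_m) : bool :=
  [forall i : 'I_m, forall j : 'I_m,
     (j == i.+1 :> nat) ==> (if odd i then pi i < pi j else pi j < pi i)].

Definition avoids_4123 (m : nat) (pi : 'S_m) : bool :=
  [forall i1 : 'I_m, forall i2 : 'I_m, forall i3 : 'I_m, forall i4 : 'I_m,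
     [&& i1 < i2, i2 < i3 & i3 < i4] ==>
       ~~ [&& pi i2 < pi i3, pi i3 < pi i4 & pi i4 < pi i1]].

Definition DU_4123 (m : nat) : {set 'S_m} :=
  [set pi | down_up pi && avoids_4123 pi].

(* The cell (i; j) is the j-th cell, from 0, of the i-th row, from 0, of the
   shifted diagram; its 1-based coordinates are [cell_row] and [cell_col]. *)
Definition cell (la : seq nat) : finType :=
  {i : 'I_(size la) & 'I_(nth 0 la i)}.

Definition cell_row (la : seq nat) (c : cell la) : nat := (tag c).+1.

Definition cell_col (la : seq nat) (c : cell la) : nat := cell_row c + tagged c.

(* The number written in the cell c is (T c).+1. *)
Definition filling (la : seq nat) : finType :=
  {ffun cell la -> 'I_(sumn la)}.

Definition shifted_standard (la : seq nat) (T : filling la) : bool :=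
  [&& [forall k, #|[set c | T c == k]| == 1],
      [forall c, forall d,
         (cell_row c == cell_row d) && (cell_col c < cell_col d) ==> (T c < T d)] &
      [forall c, forall d,
         (cell_col c == cell_col d) && (cell_row c < cell_row d) ==> (T c < T d)]].

Definition ShSYT (la : seq nat) : {set filling la} :=
  [set T | shifted_standard T].

(* The (i, j)-entry with 1-based coordinates, and 0 outside the diagram. *)
Definition entry (la : seq nat) (T : filling la) (i j : nat) : nat :=
  if [pick c | (cell_row c == i) && (cell_col c == j)] is Some c then (T c).+1 else 0.

(* Main.v *)
(* Both families are grown recursively and a pair of statistics is shown to follow
   the same rule.

   A down-up 4123-avoiding word is grown by prepending two letters.  Let e be its
   first letter (letters start at 0) and S the set of t with 0 < t < e such that
   t - 1 stands before t.  A valley a and a peak v may be prepended iff a <= e,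
   a < v <= e + 2 and no t in S has a < t < v - 1; the new set consists of the
   elements of S below a, together with a + 1 if a + 1 < v.  A tableau is grown by
   adding a last column.  If A and B entries exceed the last entries of rows 1 and
   2, the new pairs (A', B') are those with 0 < B' <= B + 1 and B' < A' <= A + 2.

   The pair (e + 1, e - max S) also follows this rule.  This fails word by word,
   since a decrease of e uncovers the smaller elements of S, but it holds for the
   multiset of all sets S that occur with a given e.  Indeed these multisets are
   sums of iterates, starting from the empty set, of the move [raise] from e to
   e + 2, which puts some a + 1 with max S <= a <= e on top of the elements of S
   below a.  The move [cut] from e to e - 1, which removes e - 1, preserves such
   sums and shifts the distribution of max S on them by one. *)

Require Import Defs.
From mathcomp Require Import all_boot all_fingroup.
From mathcomp Require Import zify.

Set Implicit Arguments.
Unset Strict Implicit.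
Unset Printing Implicit Defensive.

(** * Monotone functions, multisets and bijections *)

Lemma ltn_homo_interval (f : nat -> nat) a b : (forall i, a <= i < b -> f i < f i.+1) ->
  forall i j, a <= i -> i < j <= b -> f i < f j.
Proof.
move=> f_step i j ai /andP[ij jb].
have f_homo : {in [pred k | a <= k <= b] &, {homo f : k l / k < l}}.
  apply: homo_ltn_in => [k l m|k l|k]; first exact: ltn_trans.
    by rewrite !inE => kab lab m; rewrite inE; lia.
  by rewrite !inE => kab kab'; apply: f_step; lia.
by apply: f_homo; rewrite ?inE; lia.
Qed.

Lemma count_ltn_index_iota k m n : count (gtn k) (index_iota m n) = minn k n - m.
Proof.
rewrite /index_iota; move dE: (n - m) => d.
elim: d m dE => [|d IH] m dE /=; first lia.
by rewrite IH; lia.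
Qed.

Lemma perm_flatten_fibers (T U : eqType) (h : T -> nat) (F : T -> seq U) k n (r : seq T) :
  {in r, forall x, k <= h x < n} ->
  perm_eq (flatten [seq F x | x <- r])
          (flatten [seq flatten [seq F x | x <- r & h x == e] | e <- index_iota k n]).
Proof.
move=> h_r; apply/seq.permP => p; rewrite !count_flatten !sumnE !big_map.
under [RHS]eq_bigr do rewrite count_flatten sumnE !big_map big_filter big_mkcond.
rewrite exchange_big; apply: eq_big_seq => x /h_r x_kn.
rewrite (bigD1_seq (h x)) ?iota_uniq ?mem_index_iota //= eqxx big1 ?addn0 // => e.
by rewrite eq_sym => /negbTE->.
Qed.

Lemma perm_codom (X : finType) (T : eqType) (g : X -> T) (r : seq T) :
  injective g -> uniq r -> (forall y, y \in r <-> exists x, g x = y) ->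
  perm_eq (codom g) r.
Proof.
move=> g_inj uniq_r rP; apply: uniq_perm => // [|y]; first exact/injectiveP.
by apply/codomP/idP => [[x ->]|/rP[x <-]]; [apply/rP; exists x|exists x].
Qed.

Lemma bij_of_perm_codom (X Y : finType) (T : eqType) (s : X -> T) (t : Y -> T) :
  perm_eq (codom s) (codom t) -> exists f, bijective f /\ forall x, t (f x) = s x.
Proof.
move=> st; have cardXY : #|X| = #|Y| by rewrite -(size_codom s) (perm_size st) size_codom.
have /tuple_permP[p sE] : perm_eq (codom s) (codom_tuple t) := st.
pose f x := enum_val (p (cast_ord cardXY (enum_rank x))) : Y.
exists f; split.
  exists (fun y => enum_val (cast_ord (esym cardXY) (p^-1%g (enum_rank y)))) => [x|y].
    by rewrite /f enum_valK permK cast_ordK enum_rankK.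
  by rewrite /f enum_valK cast_ordKV permKV enum_rankK.
move=> x; have := congr1 (fun r => nth (s x) r (enum_rank x)) sE.
rewrite nth_codom enum_rankK -[val (enum_rank x)]/(val (cast_ord cardXY (enum_rank x))).
by rewrite -tnth_nth tnth_mktuple (tnth_nth (s x)) nth_codom.
Qed.

Lemma injective_card_fibers (A B : finType) (f : A -> B) : #|A| = #|B| ->
  injective f <-> [forall b, #|[set a | f a == b]| == 1].
Proof.
move=> cardAB; split=> [f_inj|/forallP fib a a' Ea].
  apply/forallP => b; have [g fK gK] := inj_card_bij f_inj (eq_leq (esym cardAB)).
  apply/cards1P; exists (g b); apply/setP => a; rewrite !inE.
  by apply/eqP/eqP => [<-|->].
have /cards1P[x fibE] := fib (f a).
have a_x : a \in [set x] by rewrite -fibE inE.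
have a'_x : a' \in [set x] by rewrite -fibE inE Ea.
by move: a_x a'_x; rewrite !inE => /eqP-> /eqP->.
Qed.

(** * Stacks *)

(* A stack of level e is a list s with [path gtn e s]: it decreases and its
   elements are less than e.  Lists of stacks are used as multisets. *)
Section Stacks.

Implicit Types (s : seq nat) (L M : seq (seq nat)).

Lemma gtn_trans : transitive gtn.
Proof. by move=> y x z xy yz; apply: ltn_trans yz xy. Qed.

Lemma path_gtnE e s : path gtn e s = all (gtn e) s && sorted gtn s.
Proof. exact: path_sortedE gtn_trans _ _. Qed.

Lemma path_gtnW e e' s : e <= e' -> path gtn e s -> path gtn e' s.
Proof. by case: s => //= t s le /andP[te ->]; rewrite andbT; apply: leq_trans le. Qed.

Lemma all_path_gtnW e e' L : e <= e' -> all (path gtn e) L -> all (path gtn e') L.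
Proof. by move=> le; apply: sub_all => s; apply: path_gtnW. Qed.

Lemma head_path_gtn e s : path gtn e s -> head 0 s <= e.
Proof. by case: s => //= t s /andP[/ltnW]. Qed.

Lemma filter_path_gtn e k s : e <= k -> path gtn e s -> [seq t <- s | t < k] = s.
Proof.
rewrite path_gtnE => ek /andP[lt_e _].
by apply/all_filterP; apply: sub_all lt_e => t te; apply: leq_trans ek.
Qed.

Lemma path_gtn_filter e k s : path gtn e s -> path gtn k [seq t <- s | t < k].
Proof.
rewrite !path_gtnE filter_all => /andP[_ sorted_s].
exact: sorted_filter gtn_trans _ _ sorted_s.
Qed.

Definition cut k L := [seq [seq t <- s | t < k] | s <- L].

Definition push y L := [seq y :: s | s <- L].

Definition raise h L :=
  [seq a.+1 :: [seq t <- s | t < a] | s <- L, a <- index_iota (head 0 s) h].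

Lemma cut_cat k L M : cut k (L ++ M) = cut k L ++ cut k M.
Proof. exact: map_cat. Qed.

Lemma perm_cut k L M : perm_eq L M -> perm_eq (cut k L) (cut k M).
Proof. exact: perm_map. Qed.

Lemma cut_cut k h L : k <= h -> cut k (cut h L) = cut k L.
Proof.
move=> kh; rewrite /cut -map_comp; apply: eq_map => s /=.
by rewrite -filter_predI; apply: eq_filter => t /=; lia.
Qed.

Lemma cut_id e k L : e <= k -> all (path gtn e) L -> cut k L = L.
Proof. by move=> ek /allP stL; apply: map_id_in => s /stL/(filter_path_gtn ek). Qed.

Lemma cut_push e L : all (path gtn e) L -> cut e (push e L) = L.
Proof.
move=> /allP stL; rewrite /cut -map_comp; apply: map_id_in => s /stL st_s /=.
by rewrite ltnn (filter_path_gtn _ st_s).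
Qed.

Lemma raise_cat h L M : raise h (L ++ M) = raise h L ++ raise h M.
Proof. exact: allpairs_cat. Qed.

Lemma perm_raise h L M : perm_eq L M -> perm_eq (raise h L) (raise h M).
Proof. by move=> LM; apply: perm_allpairs_dep. Qed.

Lemma all_path_gtn_raise e h L : all (path gtn e) L -> all (path gtn h.+1) (raise h L).
Proof.
move=> /allP stL; apply/all_allpairsP => s a /stL st_s.
by rewrite mem_index_iota /= ltnS => /andP[_ ->]; apply: path_gtnW (path_gtn_filter a st_s).
Qed.

Lemma raiseS e L : all (path gtn e) L ->
  perm_eq (raise e.+1 L) (raise e L ++ push e.+1 L).
Proof.
move=> /allP stL.
have -> : push e.+1 L = [seq a.+1 :: [seq t <- s | t < a] | s <- L, a <- [:: e]].
  by rewrite allpairs1r; apply/eq_in_map => s /stL st_s; rewrite (filter_path_gtn _ st_s).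
rewrite perm_sym -perm_allpairs_catr.
apply: perm_allpairs_dep => // s /stL/head_path_gtn le_e.
by rewrite /index_iota subSn // -addn1 iotaD subnKC.
Qed.

Lemma raise_push e L : all (path gtn e) L -> raise e.+1 (push e L) = push e.+1 L.
Proof.
move=> /allP stL; rewrite /raise allpairs_mapl /=.
have -> : index_iota e e.+1 = [:: e] by rewrite /index_iota subSnn.
rewrite allpairs1r; apply/eq_in_map => s /stL st_s /=.
by rewrite ltnn (filter_path_gtn _ st_s).
Qed.

(* The new multiset stands on top of a copy of the old one: in a raised stack
   the largest possible new element e + 1 leaves the old stack unchanged. *)
Lemma cut_raise e L : all (path gtn e) L ->
  perm_eq (cut e.+1 (raise e.+1 L)) (raise e L ++ L).
Proof.
move=> stL; apply: perm_trans (perm_cut _ (raiseS stL)) _.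
rewrite cut_cat (cut_id _ (all_path_gtn_raise e stL)) //.
by rewrite cut_push // (all_path_gtnW _ stL).
Qed.

Lemma cut_raise_raise e L : all (path gtn e) L ->
  perm_eq (cut e.+3 (raise e.+3 (raise e.+1 L)))
          (raise e.+2 (cut e.+1 (raise e.+1 L))).
Proof.
move=> stL.
have stL_succ : all (path gtn e.+1) L by apply: all_path_gtnW stL.
have stR := all_path_gtn_raise e.+1 stL.
have raise_raise : perm_eq (raise e.+2 (raise e.+1 L))
                           (raise e.+2 (raise e L) ++ push e.+2 L).
  by rewrite -(raise_push stL_succ) -raise_cat; apply: perm_raise; apply: raiseS.
have raise_cut : perm_eq (raise e.+2 (cut e.+1 (raise e.+1 L)))
                         (raise e.+2 (raise e L) ++ raise e.+1 L ++ push e.+2 L).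
  apply: perm_trans (perm_raise _ (cut_raise stL)) _.
  by rewrite raise_cat perm_cat2l raiseS.
rewrite (permPl (cut_raise stR)) (permPr raise_cut).
rewrite (permPl (perm_cat raise_raise (perm_refl _))) -catA perm_cat2l.
by rewrite perm_catC.
Qed.

Inductive raise_span : nat -> seq (seq nat) -> Prop :=
| raise_span_nil e : raise_span e [::]
| raise_span_empty e : raise_span e [:: [::]]
| raise_span_raise e L : raise_span e L -> raise_span e.+2 (raise e.+1 L)
| raise_span_cat e L M : raise_span e L -> raise_span e M -> raise_span e (L ++ M)
| raise_span_perm e L M : perm_eq L M -> raise_span e L -> raise_span e M.

Lemma raise_span_path e L : raise_span e L -> all (path gtn e) L.
Proof.
elim=> {e L} // [e L _ stL|e L M _ stL _ stM|e L M LM _].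
- exact: all_path_gtn_raise stL.
- by rewrite all_cat stL.
- by rewrite (perm_all _ LM).
Qed.

Lemma raise_span_cut_pred e L : raise_span e L -> raise_span e.-1 (cut e.-1 L).
Proof.
suff: raise_span e L ->
    raise_span e.-1 (cut e.-1 L) /\ raise_span e.+1 (cut e.+1 (raise e.+1 L)).
  by move=> h /h[].
elim=> {e L} [e|e|e L spL [_ IH]|e L M _ [spL spRL] _ [spM spRM]|e L M LM _ [spL spRL]].
- by split; apply: raise_span_nil.
- split; first exact: raise_span_empty.
  have := @cut_raise e [:: [::]] isT; rewrite perm_sym.
  move/raise_span_perm; apply; apply: raise_span_cat; last exact: raise_span_empty.
  case: e => [|e]; first exact: raise_span_nil.
  by apply: raise_span_raise; apply: raise_span_empty.
- split=> //; have := cut_raise_raise (raise_span_path spL); rewrite perm_sym.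
  by move/raise_span_perm; apply; apply: raise_span_raise.
- by rewrite raise_cat !cut_cat; split; apply: raise_span_cat.
- split; first exact: raise_span_perm (perm_cut _ LM) spL.
  exact: raise_span_perm (perm_cut _ (perm_raise _ LM)) spRL.
Qed.

Lemma raise_span_cut f e L : f <= e -> raise_span e L -> raise_span f (cut f L).
Proof.
move=> /subnK <-; elim: (e - f) L => [|d IH] L spL.
  by rewrite (cut_id _ (raise_span_path spL)).
by rewrite -(@cut_cut f (d + f)) ?leq_addl //; apply: IH (raise_span_cut_pred spL).
Qed.

Lemma raise_span_flatten (T : eqType) (r : seq T) (F : T -> seq (seq nat)) e :
  {in r, forall x, raise_span e (F x)} -> raise_span e (flatten [seq F x | x <- r]).
Proof.
elim: r => [|x r IH] spF /=; first exact: raise_span_nil.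
apply: raise_span_cat; first by apply: spF; apply: mem_head.
by apply: IH => y yr; apply: spF; rewrite inE yr orbT.
Qed.

Definition count_head_lt k L := count (fun s => head 0 s < k) L.

Definition count_head_eq r L := count (fun s => head 0 s == r) L.

Lemma count_head_ltS k L : count_head_lt k.+1 L = count_head_lt k L + count_head_eq k L.
Proof.
rewrite /count_head_lt /count_head_eq -count_predUI.
rewrite [X in _ + X](_ : _ = 0) ?addn0; first by apply: eq_count => s /=; lia.
by rewrite -[RHS](count_pred0 L); apply: eq_count => s /=; lia.
Qed.

Lemma count_head_lt_raise k h L :
  count_head_lt k.+1 (raise h L) = \sum_(s <- L) (minn k h - head 0 s).
Proof.
rewrite /count_head_lt /raise count_flatten sumnE !big_map; apply: eq_bigr => s _.
by rewrite count_map -count_ltn_index_iota; apply: eq_count => a.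
Qed.

Lemma count_head_eq_raise r h L : r <= h -> count_head_eq r (raise h L) = count_head_lt r L.
Proof.
move=> rh; rewrite /count_head_eq /count_head_lt /raise count_flatten sumnE !big_map.
rewrite -sumn_count sumnE big_map; apply: eq_bigr => s _; rewrite count_map.
case: r rh => [|r] rh; first by rewrite -[RHS](count_pred0 (index_iota (head 0 s) h)).
rewrite (@eq_count _ _ (pred1 r)); last by move=> a /=; rewrite eqSS.
by rewrite count_uniq_mem ?iota_uniq // mem_index_iota ltnS rh andbT.
Qed.

Lemma count_head_lt_cut_pred k e L : raise_span e L ->
  count_head_lt k.+1 (cut e.-1 L) = count_head_lt k.+2 L.
Proof.
elim=> {e L} // [e L spL _|e L M _ IHL _ IHM|e L M LM _ IH].
- have stL := raise_span_path spL.
  rewrite [LHS](seq.permP (cut_raise stL)) count_cat -!/(count_head_lt _ _).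
  rewrite !count_head_lt_raise.
  rewrite /count_head_lt -sumn_count sumnE big_map -big_split /=.
  by apply: eq_big_seq => s /(allP stL)/head_path_gtn; lia.
- by rewrite cut_cat /count_head_lt !count_cat -!/(count_head_lt _ _) IHL IHM.
- by move: IH; rewrite /count_head_lt (seq.permP LM) (seq.permP (perm_cut _ LM)).
Qed.

Lemma count_head_lt_cut k f e L : f <= e -> raise_span e L ->
  count_head_lt k.+1 (cut f L) = count_head_lt (k + (e - f)).+1 L.
Proof.
move=> /subnK {1}<-; elim: (e - f) k L => [|d IH] k L spL.
  by rewrite (cut_id _ (raise_span_path spL)) ?addn0.
rewrite -(@cut_cut f (d + f)) ?leq_addl // IH ?addnS; last exact: raise_span_cut_pred spL.
exact: count_head_lt_cut_pred spL.
Qed.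

(* The stacks that arise when the first letter changes from e to v <= e + 2. *)
Definition next_stacks e v L := let f := minn e v.-1 in cut v (raise f.+1 (cut f L)).

Definition valleys e v s :=
  let f := minn e v.-1 in index_iota (head 0 [seq t <- s | t < f]) f.+1.

Lemma mem_valleys a e v s : 0 < v -> path gtn e s ->
  (a \in valleys e v s) = [&& a <= e, a < v & all (fun t => ~~ (a < t < v.-1)) s].
Proof.
move=> v0 st_s; rewrite /valleys mem_index_iota; set f := minn e v.-1.
have st_f := path_gtn_filter f st_s.
have -> : all (fun t => ~~ (a < t < v.-1)) s = all (geq a) [seq t <- s | t < f].
  rewrite all_filter; apply: eq_in_all => t ts /=.
  by move: st_s; rewrite path_gtnE => /andP[/allP/(_ t ts) /=]; rewrite /f; lia.
have -> : all (geq a) [seq t <- s | t < f] = (head 0 [seq t <- s | t < f] <= a).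
  case: (filter _ _) st_f => //= t s' /andP[_]; rewrite path_gtnE => /andP[lt_t _].
  by apply/andb_idr => ta; apply: sub_all lt_t => u /= /ltnW/leq_trans; apply.
by rewrite /f; lia.
Qed.

Lemma next_stacks_map (T : eqType) (g : T -> seq nat) e v (r : seq T) :
  next_stacks e v (map g r) =
  [seq [seq t <- a.+1 :: [seq t <- g x | t < a] | t < v] | x <- r, a <- valleys e v (g x)].
Proof.
rewrite /next_stacks /cut /raise map_allpairs !allpairs_mapl.
apply/eq_in_allpairs_dep => x _ a; rewrite mem_index_iota => /andP[_ af] /=.
congr (if _ then _ :: _ else _); rewrite -!filter_predI.
  by apply: eq_filter => t /=; lia.
by apply: eq_filter => t /=; lia.
Qed.

Lemma next_stacks_raise e L : all (path gtn e) L -> next_stacks e e.+2 L = raise e.+1 L.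
Proof.
move=> stL; rewrite /next_stacks (minn_idPl _) //= (cut_id _ stL) //.
exact: cut_id (all_path_gtn_raise _ stL).
Qed.

Lemma next_stacks_cut e f L : f <= e -> next_stacks e f.+1 L = cut f.+1 (raise f.+1 (cut f L)).
Proof. by move=> fe; rewrite /next_stacks (minn_idPr _). Qed.

Lemma raise_span_next_stacks e v L : 0 < v <= e.+2 -> raise_span e L ->
  raise_span v (next_stacks e v L).
Proof.
move=> /andP[v0 ve] spL; have [->|ne] := eqVneq v e.+2.
  by rewrite next_stacks_raise ?raise_span_path //; apply: raise_span_raise.
case: v v0 ve ne => // f _ fe ne; rewrite next_stacks_cut; last lia.
have fe' : f <= e by lia.
exact: raise_span_cut_pred (raise_span_raise (raise_span_cut fe' spL)).
Qed.

Lemma count_head_eq_next_stacks e v r L : r < v <= e.+2 -> raise_span e L ->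
  count_head_eq r (next_stacks e v L) = count_head_lt (r + e.+2 - v) L.
Proof.
move=> /andP[rv ve] spL; have stL := raise_span_path spL.
have [ev|ne] := eqVneq v e.+2.
  by rewrite ev next_stacks_raise // count_head_eq_raise ?addnK //; lia.
case: v rv ve ne => // f rf fe ne; rewrite next_stacks_cut; last lia.
have fe' : f <= e by lia.
rewrite [LHS](seq.permP (cut_raise (raise_span_path (raise_span_cut fe' spL)))) count_cat.
rewrite -!/(count_head_eq _ _) count_head_eq_raise // -count_head_ltS.
rewrite (count_head_lt_cut _ fe' spL).
by congr count_head_lt; lia.
Qed.

End Stacks.

(** * Words *)

Definition ins v w := v :: map (bump v) w.

Lemma bump_inj v : injective (bump v).
Proof. exact: can_inj (bumpK v). Qed.

Lemma bump_mono v : {mono bump v : x y / x < y}.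
Proof. by move=> x y; rewrite !ltnNge leq_bump2. Qed.

Lemma perm_iotaE m w : perm_eq w (iota 0 m) = [&& size w == m, uniq w & all (gtn m) w].
Proof.
apply/idP/and3P => [pw|[/eqP sz_w uniq_w /allP lt_m]].
  rewrite (perm_size pw) (perm_uniq pw) (perm_all _ pw) size_iota iota_uniq.
  by split=> //; apply/allP => x; rewrite mem_iota.
have sub_w : {subset w <= iota 0 m} by move=> x /lt_m xm; rewrite mem_iota.
have [//|_ eq_w] := uniq_min_size uniq_w sub_w; first by rewrite size_iota sz_w.
by apply: uniq_perm; rewrite ?iota_uniq.
Qed.

Lemma perm_iota_nth m w i : perm_eq w (iota 0 m) -> i < m -> nth 0 w i < m.
Proof.
rewrite perm_iotaE => /and3P[/eqP sz_w _ /allP lt_m] im.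
by apply: lt_m; rewrite mem_nth // sz_w.
Qed.

Lemma perm_iota_mem m w x : perm_eq w (iota 0 m) -> (x \in w) = (x < m).
Proof. by move=> pw; rewrite (perm_mem pw) mem_iota. Qed.

Lemma perm_iota_ins m v w :
  v <= m -> perm_eq (ins v w) (iota 0 m.+1) = perm_eq w (iota 0 m).
Proof.
move=> vm; rewrite !perm_iotaE /= size_map eqSS map_inj_uniq; last exact: bump_inj.
have -> : v \notin map (bump v) w.
  by apply/mapP => -[x _]; rewrite /bump; lia.
rewrite ltnS vm all_map /=; do 2!congr (_ && _); apply: eq_all => x /=.
by rewrite /bump; lia.
Qed.

Lemma perm_iotaS_ins m w : perm_eq w (iota 0 m.+1) ->
  exists v w0, [/\ v <= m, perm_eq w0 (iota 0 m) & w = ins v w0].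
Proof.
case: w => [|v w] pw; first by move/perm_size: pw.
have vm : v <= m by rewrite -ltnS -(perm_iota_mem _ pw) mem_head.
have vw : v \notin w by move/perm_uniq: pw; rewrite iota_uniq => /andP[].
have Ew : v :: w = ins v (map (unbump v) w).
  rewrite /ins -map_comp map_id_in // => x xw /=.
  by apply: unbumpK; apply: contraNneq vw => <-.
by exists v, (map (unbump v) w); rewrite -Ew -(perm_iota_ins _ vm) -Ew.
Qed.

Lemma ins_inj v : injective (ins v).
Proof. by move=> w w' [/(inj_map (@bump_inj v))]. Qed.

(** * Avoidance of 4123 *)

Definition no_ascent lo hi w :=
  pairwise (fun x y => ~~ [&& lo <= x, x < y & y < hi]) w.

Fixpoint no_123_below hi w :=
  if w is x :: w' then no_ascent x.+1 hi w' && no_123_below hi w' else true.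

Fixpoint no_4123 w :=
  if w is x :: w' then no_123_below x w' && no_4123 w' else true.

Lemma no_ascentP lo hi w : reflect
  (forall i j, i < j -> j < size w ->
    ~~ [&& lo <= nth 0 w i, nth 0 w i < nth 0 w j & nth 0 w j < hi])
  (no_ascent lo hi w).
Proof.
apply: (iffP (pairwiseP 0)) => [no_asc i j ij jw|no_asc i j _ jw ij]; last exact: no_asc.
by apply: no_asc => //; apply: ltn_trans jw.
Qed.

Lemma no_123_belowP hi w : reflect
  (forall i j k, i < j -> j < k -> k < size w ->
    ~~ [&& nth 0 w i < nth 0 w j, nth 0 w j < nth 0 w k & nth 0 w k < hi])
  (no_123_below hi w).
Proof.
elim: w => [|x w IH] /=; first by constructor.
apply: (iffP andP) => [[/no_ascentP no_asc /IH no123] [|i] [|j] [|k] // ij jk kw|no123].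
- exact: no_asc.
- exact: no123.
split; first by apply/no_ascentP => j k jk kw; apply: (no123 0 j.+1 k.+1).
by apply/IH => i j k ij jk kw; apply: (no123 i.+1 j.+1 k.+1).
Qed.

Lemma no_4123P w : reflect
  (forall i j k l, i < j -> j < k -> k < l -> l < size w ->
    ~~ [&& nth 0 w j < nth 0 w k, nth 0 w k < nth 0 w l & nth 0 w l < nth 0 w i])
  (no_4123 w).
Proof.
elim: w => [|x w IH] /=; first by constructor.
apply: (iffP andP) => [[/no_123_belowP no123 /IH no4123] [|i] [|j] [|k] [|l] // ij jk kl lw|no4123].
- exact: no123.
- exact: no4123.
split; first by apply/no_123_belowP => j k l jk kl lw; apply: (no4123 0 j.+1 k.+1 l.+1).
by apply/IH => i j k l ij jk kl lw; apply: (no4123 i.+1 j.+1 k.+1 l.+1).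
Qed.

Section OrderEmbedding.

Variables (f : nat -> nat) (f_mono : {mono f : x y / x < y}).

Lemma no_ascent_map lo hi lo' hi' w :
  (forall x, (lo <= f x) = (lo' <= x)) -> (forall x, (f x < hi) = (x < hi')) ->
  no_ascent lo hi (map f w) = no_ascent lo' hi' w.
Proof.
move=> loE hiE; rewrite /no_ascent pairwise_map; apply: eq_pairwise => x y /=.
by rewrite loE f_mono hiE.
Qed.

Lemma no_123_below_map hi hi' w : (forall x, (f x < hi) = (x < hi')) ->
  no_123_below hi (map f w) = no_123_below hi' w.
Proof.
move=> hiE; elim: w => //= x w ->; congr (_ && _).
by apply: no_ascent_map.
Qed.

Lemma no_4123_map w : no_4123 (map f w) = no_4123 w.
Proof. by elim: w => //= x w ->; rewrite (@no_123_below_map _ x). Qed.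

End OrderEmbedding.

Lemma no_123_belowW hi hi' w : {in w, forall x, x < hi -> x < hi'} ->
  no_123_below hi' w -> no_123_below hi w.
Proof.
move=> hiW /no_123_belowP no123; apply/no_123_belowP => i j k ij jk kw.
apply: contra (no123 i j k ij jk kw) => /and3P[-> -> /=].
exact/hiW/mem_nth.
Qed.

Lemma no_123_below_head hi x w :
  x \notin w -> hi <= x.+1 -> no_4123 (x :: w) -> no_123_below hi (x :: w).
Proof.
move=> xw hi_x /= /andP[no123 _]; apply/andP; split.
  by apply/no_ascentP => i j _ _; lia.
by apply: no_123_belowW no123 => y yw; have: y != x by [apply: contraNneq xw => <-]; lia.
Qed.

(** * Down-up words avoiding 4123 *)

Fixpoint alternating (down : bool) w : bool :=
  if w is x :: w' then
    (if w' is y :: _ then if down then y < x else x < y else true) &&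
    alternating (~~ down) w'
  else true.

Lemma alternatingP down w : reflect (forall i, i.+1 < size w ->
    if down (+) odd i then nth 0 w i.+1 < nth 0 w i else nth 0 w i < nth 0 w i.+1)
  (alternating down w).
Proof.
elim: w down => [|x [|y w] IH] down; [by constructor|by constructor|].
apply: (iffP andP) => [[xy /IH alt_w] [|i] /= iw|alt_w].
- by case: down xy {alt_w}.
- by have := alt_w i iw; case: down {xy alt_w}; case: (odd i).
split; first by have := alt_w 0 isT; case: down {alt_w}.
by apply/IH => i iw; have := alt_w i.+1 iw; case: down {alt_w} => /=; case: (odd i).
Qed.

Lemma alternating_map f down w : {mono f : x y / x < y} ->
  alternating down (map f w) = alternating down w.
Proof.
move=> f_mono; elim: w down => //= x [|y w] IH down //.
by rewrite IH /= !f_mono.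
Qed.

Definition du4123 w := alternating true w && no_4123 w.

Definition precedes (w : seq nat) x y := index x w < index y w.

Definition inv_ascents w :=
  [seq t <- rev (iota 1 (head 0 w).-1) | precedes w t.-1 t].

Lemma mem_inv_ascents w t :
  (t \in inv_ascents w) = (0 < t < head 0 w) && precedes w t.-1 t.
Proof. by rewrite mem_filter mem_rev mem_iota andbC; congr (_ && _); lia. Qed.

Lemma sorted_inv_ascents w : sorted gtn (inv_ascents w).
Proof. by apply: sorted_filter gtn_trans _ _ _; rewrite rev_sorted iota_ltn_sorted. Qed.

Lemma path_inv_ascents w : path gtn (head 0 w) (inv_ascents w).
Proof.
rewrite path_gtnE sorted_inv_ascents andbT; apply/allP => t.
by rewrite mem_inv_ascents => /andP[/andP[]].
Qed.

Lemma precedes_head x y w : precedes (x :: w) x y = (x != y).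
Proof. by rewrite /precedes /= eqxx; case: eqP. Qed.

Lemma precedes_headr x y w : precedes (x :: w) y x = false.
Proof. by rewrite /precedes /= eqxx ltn0. Qed.

Lemma precedes_ins_bump v w x y :
  precedes (ins v w) (bump v x) (bump v y) = precedes w x y.
Proof. by rewrite /precedes /= !(negbTE (neq_bump _ _)) !index_map //; apply: bump_inj. Qed.

Lemma precedes_ins_lt v w t : 0 < t < v -> precedes (ins v w) t.-1 t = precedes w t.-1 t.
Proof.
move=> tv; have bump_id x : x <= t -> bump v x = x by rewrite /bump; lia.
by rewrite -[RHS](precedes_ins_bump v) !bump_id // leq_pred.
Qed.

Lemma precedes_unit_step w x y : x < y -> precedes w x y ->
  exists2 t, x < t <= y & precedes w t.-1 t.
Proof.
elim: y => // y IH xy w_xy.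
have [w_y|w_y] := ltnP (index y w) (index y.+1 w); first by exists y.+1; rewrite //= xy /=.
have [Exy|ne] := eqVneq x y; first by move: w_xy; rewrite /precedes Exy ltnNge w_y.
have [||t xty w_t] := IH; [lia|exact: leq_trans w_xy w_y|].
by exists t => //; lia.
Qed.

Lemma no_ascent_not_precedes lo hi w x y : no_ascent lo hi w ->
  lo <= x -> x < y < hi -> y \in w -> ~~ precedes w x y.
Proof.
move=> /no_ascentP no_asc lo_x /andP[xy y_hi] yw; apply/negP => w_xy.
have index_y : index y w < size w by rewrite index_mem.
have xw : x \in w by rewrite -index_mem; apply: ltn_trans w_xy index_y.
by have := no_asc _ _ w_xy index_y; rewrite !nth_index // lo_x xy y_hi.
Qed.

Lemma no_ascent_inv_ascents m w a h : perm_eq w (iota 0 m.+1) -> a <= head 0 w ->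
  h <= m.+1 -> no_ascent a h w =
    (h <= (head 0 w).+1) && all (fun t => ~~ (a < t < h)) (inv_ascents w).
Proof.
case: w => [|e w] pw; first by move/perm_size: pw.
rewrite [head 0 _]/= => ae hm; apply/idP/andP => [no_asc|[he /allP gapS]].
  split.
    rewrite leqNgt; apply/negP => eh.
    have ew : e.+1 \in e :: w by rewrite (perm_iota_mem _ pw); lia.
    have := no_ascent_not_precedes no_asc ae _ ew; rewrite precedes_head ltnSn /= eh.
    by move=> /(_ isT); lia.
  apply/allP => t; rewrite mem_inv_ascents => /andP[/andP[t0 te] w_t].
  apply/negP => /andP[lt_at th].
  have tw : t \in e :: w by rewrite (perm_iota_mem _ pw); lia.
  have /negP[] // : ~~ precedes (e :: w) t.-1 t.
  by apply: no_ascent_not_precedes no_asc _ _ tw; lia.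
apply/no_ascentP => i j ij jw; apply/negP => /and3P[a_wi wij wj_h].
have uniq_w : uniq (e :: w) by rewrite (perm_uniq pw) iota_uniq.
have [|t xty w_t] := precedes_unit_step (w := e :: w) wij.
  by rewrite /precedes !index_uniq //; apply: ltn_trans jw.
have te : t != e by apply: contraTneq w_t => ->; rewrite precedes_headr.
by have := gapS t; rewrite mem_inv_ascents w_t andbT /=; lia.
Qed.

Section PrependTwo.

Variables (m : nat) (w : seq nat) (a v : nat).
Hypothesis perm_w : perm_eq w (iota 0 m.+1).

Let e := head 0 w.

Let head_in : e \in w.
Proof. by rewrite /e; case: (w) perm_w => [/perm_size//|x s _]; apply: mem_head. Qed.

Lemma alternating_ins2 :
  alternating true (ins v (ins a w)) = [&& a < v, a <= e & alternating true w].
Proof.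
rewrite /e; case: (w) head_in => [|x s] // _.
rewrite /ins [map (bump v) _]/= -map_comp.
rewrite -[LHS]/[&& bump v a < v, bump v a < (bump v \o bump a) x &
  alternating true (map (bump v \o bump a) (x :: s))].
rewrite alternating_map => [|y z]; last by rewrite /= !bump_mono.
rewrite [(_ \o _) x]/= bump_mono.
by congr [&& _, _ & _]; rewrite /bump /=; lia.
Qed.

Lemma no_4123_ins2 : a <= e -> a < v -> v <= m.+2 ->
  no_4123 (ins v (ins a w)) = no_4123 w && no_ascent a v.-1 w.
Proof.
move=> ae av vm.
have f_mono : {mono bump v \o bump a : x y / x < y} by move=> x y; rewrite /= !bump_mono.
have lt_v x : ((bump v \o bump a) x < v) = (x < v.-1) by rewrite /bump /=; lia.
have lt_a x : ((bump v \o bump a) x < a) = (x < a) by rewrite /bump /=; lia.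
have le_a x : (a.+1 <= (bump v \o bump a) x) = (a <= x) by rewrite /bump /=; lia.
have -> : ins v (ins a w) = v :: a :: map (bump v \o bump a) w.
  by rewrite /ins /= -map_comp (_ : bump v a = a) // /bump; lia.
rewrite [LHS]/= (no_ascent_map f_mono _ le_a lt_v) (no_123_below_map f_mono _ lt_v).
rewrite (no_123_below_map f_mono _ lt_a) (no_4123_map f_mono).
apply/idP/andP => [/andP[/andP[-> _] /andP[_ ->]]|[no4123 no_asc]] //.
have below hi : hi <= e.+1 -> no_123_below hi w.
  have : uniq w by rewrite (perm_uniq perm_w) iota_uniq.
  rewrite /e; case: (w) head_in no4123 => // x s _ no4123 /= /andP[xs _] hi_x.
  exact: no_123_below_head no4123.
move: (no_asc); rewrite {1}(no_ascent_inv_ascents perm_w ae); last lia.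
by case/andP=> ve _; rewrite no_asc no4123 !below //; lia.
Qed.

Lemma inv_ascents_ins2 : a <= e -> v <= e.+2 ->
  all (fun t => ~~ (a < t < v.-1)) (inv_ascents w) -> a < v ->
  inv_ascents (ins v (ins a w)) =
    [seq t <- a.+1 :: [seq t <- inv_ascents w | t < a] | t < v].
Proof.
move=> ae ve /allP gapS av; apply: (irr_sorted_eq gtn_trans) => [x|||t].
- by rewrite /= ltnn.
- exact: sorted_inv_ascents.
- apply: sorted_filter gtn_trans _ _ _ => /=; apply: path_gtnW (leqnSn a) _.
  exact: path_gtn_filter (path_inv_ascents w).
rewrite mem_inv_ascents mem_filter inE mem_filter mem_inv_ascents -/e [head _ _]/=.
have [|out] := boolP (0 < t < v); last first.
  by rewrite andFb; apply/esym/negP => /andP[tv /orP[|/and3P[]]]; lia.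
move=> /[dup] t0v /andP[t0 tv]; rewrite t0 tv precedes_ins_lt //=.
case: (ltngtP t a) => [ta|ta|->].
- by rewrite precedes_ins_lt ?t0 // ltn_eqF ?(leq_trans ta) //=; lia.
- rewrite orbF; have [->|ne] := eqVneq t a.+1; first by rewrite precedes_head; lia.
  have -> : precedes (ins a w) t.-1 t = precedes w t.-2 t.-1.
    by rewrite -[RHS](precedes_ins_bump a); congr precedes; rewrite /bump; lia.
  apply/negP => w_t; have te : t.-1 != e.
    apply: contraTneq w_t => ->.
    by rewrite /e; case: (w) head_in => //= *; rewrite precedes_headr.
  by have := gapS t.-1; rewrite mem_inv_ascents w_t andbT -/e; lia.
- by rewrite precedes_headr orbF; lia.
Qed.

Lemma du4123_ins2 : 0 < v <= m.+2 -> du4123 (ins v (ins a w)) =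
  [&& du4123 w, v <= e.+2 & a \in valleys e v (inv_ascents w)].
Proof.
move=> /andP[v0 vm]; rewrite /du4123 alternating_ins2.
rewrite (mem_valleys _ v0 (path_inv_ascents w)).
have [av|] := boolP (a < v); last by rewrite !andbF.
have [ae|] := boolP (a <= e); last by rewrite !andbF.
rewrite no_4123_ins2 // (no_ascent_inv_ascents perm_w ae); last lia.
by rewrite -/e (_ : (v.-1 <= e.+1) = (v <= e.+2)) /= ?andbA //; lia.
Qed.

End PrependTwo.

Definition du_words m := [seq w <- permutations (iota 0 m) | du4123 w].

Lemma mem_du_words m w : (w \in du_words m) = du4123 w && perm_eq w (iota 0 m).
Proof. by rewrite mem_filter mem_permutations. Qed.

Lemma du_words_uniq m : uniq (du_words m).
Proof. by rewrite filter_uniq ?permutations_uniq. Qed.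

Lemma head_du_words m w : w \in du_words m.+1 -> head 0 w <= m.
Proof. by rewrite mem_du_words -nth0 => /andP[_ /perm_iota_nth]; apply. Qed.

Lemma perm_du_words_head m v : 0 < v -> perm_eq
  [seq w <- du_words m.+3 | head 0 w == v]
  [seq ins v (ins a w) | w <- [seq w <- du_words m.+1 | v <= (head 0 w).+2],
                         a <- valleys (head 0 w) v (inv_ascents w)].
Proof.
move=> v0; apply: uniq_perm.
- by rewrite filter_uniq ?du_words_uniq.
- apply: allpairs_uniq_dep => [|w _|[w a] [w' a'] _ _ /= /ins_inj[<- /inj_map ww']].
  + exact/filter_uniq/du_words_uniq.
  + exact: iota_uniq.
  + by rewrite ww' //; apply: bump_inj.
move=> w'; rewrite mem_filter mem_du_words; apply/idP/allpairsPdep.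
  case/and3P=> /eqP head_w' du_w' /perm_iotaS_ins[v' [w1 [v'm pw1 Ew']]].
  have [a [w [am pw Ew1]]] := perm_iotaS_ins pw1.
  have Ev : v' = v by rewrite -head_w' Ew'.
  move: du_w'; rewrite Ew' Ew1 Ev (du4123_ins2 _ pw); last by rewrite v0 -Ev.
  case/and3P=> du_w vw aw; exists w, a; split=> //.
  by rewrite mem_filter vw mem_du_words du_w.
case=> w [a []]; rewrite mem_filter mem_du_words => /and3P[vw du_w pw] aw ->.
have wm : head 0 w <= m by apply: head_du_words; rewrite mem_du_words du_w.
rewrite (du4123_ins2 _ pw) ?v0 ?du_w ?vw ?aw; last lia.
move: aw; rewrite (mem_valleys _ v0 (path_inv_ascents w)) => /and3P[ae _ _].
by rewrite eqxx !perm_iota_ins ?pw //; lia.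
Qed.

Definition du_stacks m e := [seq inv_ascents w | w <- du_words m & head 0 w == e].

Lemma perm_du_stacks m v : 0 < v -> perm_eq (du_stacks m.+3 v)
  (flatten [seq next_stacks e v (du_stacks m.+1 e) | e <- index_iota v.-2 m.+1]).
Proof.
move=> v0; apply: perm_trans (perm_map _ (perm_du_words_head m v0)) _.
rewrite map_allpairs; set r := filter _ _.
have r_head : {in r, forall w, v.-2 <= head 0 w < m.+1}.
  by move=> w; rewrite mem_filter => /andP[vw /head_du_words]; lia.
apply: perm_trans (perm_flatten_fibers _ r_head) _.
have /eq_in_map -> // : {in index_iota v.-2 m.+1,
    (fun e => next_stacks e v (du_stacks m.+1 e)) =1
    fun e => [seq inv_ascents (ins v (ins a w)) | w <- [seq w <- r | head 0 w == e],
                a <- valleys (head 0 w) v (inv_ascents w)]}.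
move=> e; rewrite mem_index_iota => /andP[ve _].
have -> : [seq w <- r | head 0 w == e] = [seq w <- du_words m.+1 | head 0 w == e].
  rewrite -filter_predI; apply: eq_filter => w /=; rewrite andb_idr // => /eqP->.
  by move: ve; lia.
rewrite next_stacks_map; congr flatten; apply/eq_in_map => w; rewrite mem_filter mem_du_words.
move=> /and3P[/eqP head_w _ pw]; rewrite -head_w; apply/eq_in_map => a.
rewrite (mem_valleys _ v0 (path_inv_ascents w)) => /and3P[ae av gapS].
by rewrite (inv_ascents_ins2 pw) //; lia.
Qed.

Lemma head_du_words_gt0 m w : w \in du_words m.+2 -> 0 < head 0 w.
Proof.
rewrite mem_du_words => /andP[/andP[+ _]]; case: w => [_ /perm_size//|x [_ /perm_size//|y w]].
by case/andP=> /(leq_ltn_trans (leq0n y)).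
Qed.

Lemma du_stacks0 m : du_stacks m.+2 0 = [::].
Proof.
rewrite /du_stacks (eq_in_filter (a2 := pred0)) ?filter_pred0 // => w.
by move=> /head_du_words_gt0; case: (head 0 w).
Qed.

Lemma raise_span_du_stacks n e : raise_span e (du_stacks n.*2.+1 e).
Proof.
elim: n e => [|n IH] [|v].
- exact: raise_span_empty.
- exact: raise_span_nil.
- by rewrite doubleS du_stacks0; apply: raise_span_nil.
rewrite doubleS; have := perm_du_stacks n.*2 (ltn0Sn v); rewrite perm_sym.
move/raise_span_perm; apply.
apply: raise_span_flatten => e; rewrite mem_index_iota => /andP[ve _].
by apply: raise_span_next_stacks; [lia | apply: IH].
Qed.

(* (A, B) are the numbers of entries of a tableau that exceed the last entries of
   its rows 1 and 2; the rule tells which pairs appear when a column is added. *)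
Definition column_rule (x y : nat * nat) :=
  [&& 0 < y.2, y.2 <= x.2.+1, y.2 < y.1 & y.1 <= x.1.+2].

Definition du_stat w := ((head 0 w).+1, head 0 w - head 0 (inv_ascents w)).

Lemma count_mem_du_stat m e r : r <= e ->
  count_mem (e.+1, e - r) (map du_stat (du_words m)) = count_head_eq r (du_stacks m e).
Proof.
move=> re; rewrite /count_head_eq !count_map count_filter; apply: eq_count => w /=.
rewrite xpair_eqE eqSS andbC; have [Ee|] := eqVneq (head 0 w) e; last by rewrite !andbF.
by rewrite !andbT; have := head_path_gtn (path_inv_ascents w); lia.
Qed.

Lemma du_stat_bounds m w : w \in du_words m.+2 -> 0 < (du_stat w).2 < (du_stat w).1.
Proof.
move/head_du_words_gt0 => head_w; rewrite /du_stat /= ltnS leq_subr andbT subn_gt0.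
by case: (inv_ascents w) (path_inv_ascents w) => //= t s /andP[].
Qed.

Lemma count_du_stat_column_rule m y : (forall e, raise_span e (du_stacks m.+1 e)) ->
  count_mem y (map du_stat (du_words m.+3)) =
  count (column_rule^~ y) (map du_stat (du_words m.+1)).
Proof.
move=> spL; case: y => A B; have [/andP[B0 BA]|out] := boolP (0 < B < A); last first.
  rewrite (@eq_in_count _ _ pred0) ?count_pred0.
    by rewrite (@eq_count _ _ pred0) ?count_pred0 // => x; rewrite /column_rule /=; lia.
  move=> _ /mapP[w /du_stat_bounds w_tri ->] /=; apply: contraNF out => /eqP E.
  by move: w_tri; rewrite E.
case: A BA => // v Bv; have {1}-> : B = v - (v - B) by lia.
rewrite count_mem_du_stat ?leq_subr //.
have v0 : 0 < v by lia.
rewrite /count_head_eq (seq.permP (perm_du_stacks m v0)) count_flatten sumnE !big_map.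
rewrite count_map -size_filter -[filter _ _]flatten_seq1; set r := filter _ _.
have r_head : {in r, forall w, v.-2 <= head 0 w < m.+1}.
  move=> w; rewrite mem_filter /column_rule /= => /andP[rule /head_du_words].
  by move: rule; lia.
rewrite (perm_size (perm_flatten_fibers _ r_head)) size_flatten /shape sumnE !big_map.
apply: eq_big_seq => e; rewrite mem_index_iota => /andP[ve _].
rewrite -/(count_head_eq _ _) count_head_eq_next_stacks // ?flatten_seq1; last lia.
rewrite size_filter count_filter /count_head_lt count_map count_filter; apply: eq_count => w /=.
have [Ee|] := eqVneq (head 0 w) e; last by rewrite !andbF.
by have := head_path_gtn (path_inv_ascents w); rewrite /column_rule /= Ee; lia.
Qed.

(** * Reading words of tableaux *)

(* The word of a tableau of shape (n + 2, n + 1, n): each entry x is replaced by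
   3n + 3 - x, columns are read top to bottom from right to left, and the last
   three letters are the entries (1, 2), (2, 2), (1, 1) in this order. *)
Fixpoint standard_word w : bool :=
  if w is a :: b :: c :: w' then
    match w' with
    | [::] => b < a < c
    | a' :: b' :: c' :: _ => [&& c < b < a, a < a', b < b', c < c' & standard_word w']
    | _ => false
    end
  else false.

Lemma standard_word_cons a b c a' b' c' s :
  standard_word [:: a, b, c, a', b', c' & s] =
  [&& c < b < a, a < a', b < b', c < c' & standard_word [:: a', b', c' & s]].
Proof. by []. Qed.

Lemma standard_word_ind (P : seq nat -> Prop) :
  (forall a b c, b < a < c -> P [:: a; b; c]) ->
  (forall a b c a' b' c' s, [&& c < b < a, a < a', b < b' & c < c'] ->
     P [:: a', b', c' & s] -> P [:: a, b, c, a', b', c' & s]) ->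
  forall w, standard_word w -> P w.
Proof.
move=> base step w; have [n] := ubnP (size w); elim: n w => // n IH.
case=> [|a [|b [|c [|a' [|b' [|c' s]]]]]] // size_w; first exact: base.
rewrite standard_word_cons !andbA => /andP[col st_s]; apply: step; first by rewrite !andbA.
by apply: IH st_s; move: size_w => /=; lia.
Qed.

Lemma standard_word_map f w : {mono f : x y / x < y} ->
  standard_word (map f w) = standard_word w.
Proof.
move=> f_mono; have [n] := ubnP (size w); elim: n w => // n IH.
case=> [|a [|b [|c [|a' [|b' [|c' s]]]]]] // size_w; first by rewrite /= !f_mono.
rewrite [map _ _]/= !standard_word_cons !f_mono -(IH [:: a', b', c' & s]) //.
by move: size_w => /=; lia.
Qed.

Lemma standard_word_lt w : standard_word w -> nth 0 w 1 < nth 0 w 0.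
Proof. by elim/standard_word_ind: w / => [a b c /andP[]|a b c a' b' c' s /and4P[/andP[]]] //=. Qed.

Lemma standard_word_min w :
  standard_word w -> all (leq (minn (nth 0 w 1) (nth 0 w 2))) w.
Proof.
elim/standard_word_ind: w / => [a b c|a b c a' b' c' s] /=; first lia.
move=> col /and4P[_ _ _ min_s].
have -> : all (leq (minn b c)) s by apply: sub_all min_s => x; lia.
by lia.
Qed.

Definition tab_stat w := (nth 0 w 0, nth 0 w 1).

Lemma bump_column_rule a b c a' b' c' : b' < a' -> minn b' c' = 0 ->
  [&& bump a (bump b c) < bump a b < a, a < bump a (bump b (bump c a')),
      bump a b < bump a (bump b (bump c b')) &
      bump a (bump b c) < bump a (bump b (bump c c'))] =
  (c == 0) && column_rule (a', b') (a, b).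
Proof.
rewrite /column_rule !bump_mono => b'a' min0.
have [->|c0] := posnP c; first by rewrite /bump /=; lia.
by rewrite /bump /=; lia.
Qed.

Lemma standard_word_ins3 m w a b c : perm_eq w (iota 0 m.+1) ->
  standard_word (ins a (ins b (ins c w))) =
  [&& standard_word w, c == 0 & column_rule (tab_stat w) (a, b)].
Proof.
move=> pw; pose f := bump a \o (bump b \o bump c).
have f_mono : {mono f : x y / x < y} by move=> x y; rewrite /= !bump_mono.
have -> : ins a (ins b (ins c w)) = [:: a, bump a b, bump a (bump b c) & map f w].
  by rewrite /ins /= -!map_comp.
case: w pw => [|a' [|b' [|c' s]]] pw; [by move/perm_size: pw|by []|by []|].
rewrite [map _ _]/= standard_word_cons -/(map f [:: a', b', c' & s]).
rewrite standard_word_map // !andbA andbC -!andbA; apply: andb_id2l => st_w.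
have min0 : minn b' c' = 0.
  apply/eqP; rewrite -leqn0; apply: (allP (standard_word_min st_w)).
  by rewrite (perm_iota_mem _ pw).
by rewrite -(bump_column_rule _ _ _ (standard_word_lt st_w) min0) -!andbA.
Qed.

Definition tab_words m := [seq w <- permutations (iota 0 m) | standard_word w].

Lemma mem_tab_words m w : (w \in tab_words m) = standard_word w && perm_eq w (iota 0 m).
Proof. by rewrite mem_filter mem_permutations. Qed.

Lemma tab_words_uniq m : uniq (tab_words m).
Proof. by rewrite filter_uniq ?permutations_uniq. Qed.

Lemma perm_tab_words_stat m y : perm_eq
  [seq w <- tab_words m.+4 | tab_stat w == y]
  [seq ins y.1 (ins y.2 (ins 0 w)) | w <- tab_words m.+1 & column_rule (tab_stat w) y].
Proof.
case: y => A B /=; apply: uniq_perm.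
- exact/filter_uniq/tab_words_uniq.
- rewrite map_inj_uniq; first exact/filter_uniq/tab_words_uniq.
  by move=> w w' /ins_inj/ins_inj/ins_inj.
move=> w'; rewrite mem_filter mem_tab_words; apply/idP/mapP.
  case/and3P=> /eqP stat_w' st_w' /perm_iotaS_ins[a [w2 [am pw2 Ew']]].
  have [b [w1 [bm pw1 Ew2]]] := perm_iotaS_ins pw2.
  have [c [w [cm pw Ew1]]] := perm_iotaS_ins pw1.
  move: st_w'; rewrite Ew' Ew2 Ew1 (standard_word_ins3 _ _ _ pw).
  case/and3P=> st_w /eqP c0 rule.
  have ba : bump a b = b by move: rule; rewrite /column_rule /bump /=; lia.
  move: stat_w'; rewrite Ew' Ew2 /tab_stat /= ba => -[<- <-].
  by exists w; rewrite ?c0 // mem_filter rule mem_tab_words st_w.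
case=> w; rewrite mem_filter mem_tab_words => /and3P[rule st_w pw] ->.
have head_w : nth 0 w 0 <= m := perm_iota_nth pw (ltn0Sn m).
have BA : B < A <= (nth 0 w 0).+2 by case/and4P: rule => _ _ /= -> ->.
rewrite (standard_word_ins3 _ _ _ pw) st_w rule !perm_iota_ins ?pw /=; [|lia|lia|lia].
by rewrite /tab_stat /= xpair_eqE eqxx /bump; lia.
Qed.

Lemma count_tab_stat_column_rule m y :
  count_mem y (map tab_stat (tab_words m.+4)) =
  count (column_rule^~ y) (map tab_stat (tab_words m.+1)).
Proof.
rewrite !count_map -!size_filter (perm_size (perm_tab_words_stat m y)) size_map.
by congr size; apply: eq_filter.
Qed.

Lemma perm_du_tab_stat n : perm_eq
  (map du_stat (du_words n.*2.+1)) (map tab_stat (tab_words (3 * n).+3)).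
Proof.
elim: n => [|n IH]; first by [].
apply/allP => y _; apply/eqP.
rewrite doubleS (count_du_stat_column_rule _ (raise_span_du_stacks n)) (seq.permP IH).
by rewrite mulnS -count_tab_stat_column_rule.
Qed.

(** * Permutations and tableaux as words *)

Section PermutationWord.

Variable m : nat.
Implicit Type p : 'S_m.

Definition perm_word p := [seq val (p i) | i <- enum 'I_m].

Lemma size_perm_word p : size (perm_word p) = m.
Proof. by rewrite size_map size_enum_ord. Qed.

Lemma nth_perm_word p (i : 'I_m) : nth 0 (perm_word p) i = p i.
Proof. by rewrite (nth_map i) ?size_enum_ord // nth_ord_enum. Qed.

Lemma perm_word_inj : injective perm_word.
Proof. by move=> p q E; apply/permP => i; apply: val_inj; rewrite /= -!nth_perm_word E. Qed.

Lemma perm_iota_word w : perm_eq w (iota 0 m) <-> exists p, perm_word p = w.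
Proof.
split=> [pw|[p <-]]; last first.
  rewrite perm_iotaE size_perm_word eqxx all_map map_inj_uniq ?enum_uniq /=; last first.
    by move=> i j /val_inj/perm_inj.
  by apply/allP => i _ /=.
have w_lt (i : 'I_m) : nth 0 w i < m by apply: perm_iota_nth pw _.
move: (pw); rewrite perm_iotaE => /and3P[/eqP size_w uniq_w _].
have w_inj : injective (fun i => Ordinal (w_lt i)).
  by move=> i j [] /eqP; rewrite nth_uniq ?size_w // => /eqP/val_inj.
exists (perm w_inj); apply: (@eq_from_nth _ 0); rewrite size_perm_word // => i im.
by rewrite -[i]/(val (Ordinal im)) nth_perm_word permE.
Qed.

Lemma down_upE p : down_up p = alternating true (perm_word p).
Proof.
apply/idP/alternatingP => [dup i|alt].
  rewrite size_perm_word => im.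
  have /forallP/(_ (Ordinal (ltnW im)))/forallP/(_ (Ordinal im)) := dup.
  by rewrite /= eqxx -!nth_perm_word /=; case: (odd i).
apply/forallP => i; apply/forallP => j; apply/implyP => /eqP ij.
have := alt i; rewrite -ij size_perm_word ltn_ord => /(_ isT).
by rewrite !nth_perm_word; case: (odd i).
Qed.

Lemma avoids_4123E p : avoids_4123 p = no_4123 (perm_word p).
Proof.
apply/idP/no_4123P => [av i j k l ij jk kl|no4123].
  rewrite size_perm_word => lm.
  have km := ltn_trans kl lm; have jm := ltn_trans jk km; have im := ltn_trans ij jm.
  have /forallP/(_ (Ordinal im))/forallP/(_ (Ordinal jm)) := av.
  move=> /forallP/(_ (Ordinal km))/forallP/(_ (Ordinal lm)).
  by rewrite -!nth_perm_word /= ij jk kl.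
apply/forallP => i; apply/forallP => j; apply/forallP => k; apply/forallP => l.
apply/implyP => /and3P[ij jk kl]; have := no4123 i j k l ij jk kl.
by rewrite size_perm_word !nth_perm_word; apply.
Qed.

Lemma mem_DU_4123 p : (p \in DU_4123 m) = (perm_word p \in du_words m).
Proof.
have pw : perm_eq (perm_word p) (iota 0 m) by apply/perm_iota_word; exists p.
by rewrite inE mem_du_words pw andbT /du4123 down_upE avoids_4123E.
Qed.

Lemma perm_codom_du_words :
  perm_eq (codom (fun p : {p | p \in DU_4123 m} => perm_word (val p))) (du_words m).
Proof.
apply: perm_codom; last 1 first; rewrite ?du_words_uniq //.
- move=> w; split=> [w_du|[[p p_du] <-]]; last by rewrite -mem_DU_4123.
  have /perm_iota_word[p Ew] : perm_eq w (iota 0 m).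
    by move: w_du; rewrite mem_du_words => /andP[].
  have p_du : p \in DU_4123 m by rewrite mem_DU_4123 Ew.
  by exists (exist _ p p_du).
- by move=> p q /perm_word_inj/val_inj.
Qed.

Lemma letter1E p : 0 < m -> letter p 1 = (head 0 (perm_word p)).+1.
Proof.
move=> m0; rewrite /letter; case: pickP => [i /eqP[i0]|]; last by move/(_ (Ordinal m0)).
by rewrite -nth0 -nth_perm_word i0.
Qed.

End PermutationWord.

Section Cells.

Variable la : seq nat.
Implicit Types (c d : cell la) (T : filling la).

Definition cell_pos c := (cell_row c, cell_col c).

Lemma cell_pos_inj : injective cell_pos.
Proof.
move=> [i j] [i' j'] [/val_inj Ei]; subst i'.
by rewrite /cell_col /cell_row /= => /addnI/val_inj->.
Qed.

Lemma cell_posP i j : (exists c, cell_row c = i /\ cell_col c = j) <->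
  0 < i <= size la /\ i <= j < i + nth 0 la i.-1.
Proof.
split=> [[[i' j'] [<- <-]]|].
  by rewrite /cell_col /cell_row /= leq_addr ltn_add2l !ltn_ord.
case: i => [[]|i [/= i_la /andP[ij j_la]]] //.
have j_row : j - i.+1 < nth 0 la i by lia.
exists (Tagged (fun i : 'I_(size la) => 'I_(nth 0 la i))
               (Ordinal j_row : 'I_(nth 0 la (Ordinal i_la)))).
by rewrite /cell_col /cell_row /= subnKC.
Qed.

Lemma entry_cell T c : entry T (cell_row c) (cell_col c) = (T c).+1.
Proof.
rewrite /entry; case: pickP => [d /andP[/eqP Er /eqP Ec]|/(_ c)]; last by rewrite !eqxx.
by congr (T _).+1; apply: cell_pos_inj; rewrite /cell_pos Er Ec.
Qed.

Lemma entry_le T i j : entry T i j <= sumn la.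
Proof. by rewrite /entry; case: pickP. Qed.

End Cells.

Definition three_rows n := [:: n.+2; n.+1; n].

Lemma three_rows_posP n i j :
  (exists c : cell (three_rows n), cell_row c = i /\ cell_col c = j) <->
  0 < i <= 3 /\ i <= j <= n.+2.
Proof.
apply: iff_trans (cell_posP _ _ _) _.
by case: i => [|[|[|[|i]]]] /=; split; lia.
Qed.

Fixpoint three_rows_cells n : seq (nat * nat) :=
  if n is n'.+1 then [:: (1, n.+2), (2, n.+2), (3, n.+2) & three_rows_cells n']
  else [:: (1, 2); (2, 2); (1, 1)].

Lemma mem_three_rows_cells n i j :
  ((i, j) \in three_rows_cells n) = (0 < i <= 3) && (i <= j <= n.+2).
Proof.
by elim: n => [|n IH]; rewrite !inE ?IH !xpair_eqE; lia.
Qed.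

Lemma three_rows_cells_uniq n : uniq (three_rows_cells n).
Proof. by elim: n => //= n ->; rewrite !inE !mem_three_rows_cells !xpair_eqE; lia. Qed.

Lemma size_three_rows_cells n : size (three_rows_cells n) = (3 * n).+3.
Proof. by elim: n => //= n ->; lia. Qed.

Lemma standard_word_three_rows_cells n (g : nat -> nat -> nat) :
  standard_word [seq g c.1 c.2 | c <- three_rows_cells n] <->
  (forall i j, 0 < i <= 3 -> i <= j < n.+2 -> g i j.+1 < g i j) /\
  (forall i j, 0 < i < 3 -> i < j <= n.+2 -> g i.+1 j < g i j).
Proof.
elim: n => [|n IH].
  split=> [/andP[gb ga]|[row col]]; last first.
    by apply/andP; split; [apply: (col 1 2)|apply: (row 1 1)].
  by split=> [] [|[|[|[|i]]]] [|[|[|j]]].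
have -> : standard_word [seq g c.1 c.2 | c <- three_rows_cells n.+1] =
    [&& g 3 n.+3 < g 2 n.+3 < g 1 n.+3, g 1 n.+3 < g 1 n.+2, g 2 n.+3 < g 2 n.+2,
        g 3 n.+3 < (if n is 0 then g 1 1 else g 3 n.+2) &
        standard_word [seq g c.1 c.2 | c <- three_rows_cells n]] by case: (n).
split=> [/and5P[/andP[g32 g21] g1 g2 g3 /IH[row col]]|[row col]].
  split=> i j i3 /andP[ij jn].
    have [Ej|jn'] : j = n.+2 \/ j < n.+2 by lia.
      by case: i i3 ij => [|[|[|[|i]]]] // _ ij; rewrite Ej //; case: (n) g3 Ej ij => // _ ->.
    by apply: row => //; lia.
  have [->|jn'] : j = n.+3 \/ j <= n.+2 by lia.
    by case: i i3 ij => [|[|[|i]]].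
  by apply: col => //; lia.
have third_row : g 3 n.+3 < (if n is 0 then g 1 1 else g 3 n.+2).
  case: (n) row col => [|n'] row col; last by apply: row; lia.
  apply: (@ltn_trans (g 2 3)); first exact: (col 2 3).
  apply: (@ltn_trans (g 2 2)); first exact: (row 2 2).
  apply: (@ltn_trans (g 1 2)); first exact: (col 1 2).
  exact: (row 1 1).
rewrite third_row !row ?col //=.
by apply/IH; split=> i j i3 ij; [apply: row|apply: col]; lia.
Qed.

Section TableauWord.

Variable n : nat.
Implicit Type T : filling (three_rows n).

Let N := (3 * n).+3.

Lemma sumn_three_rows : sumn (three_rows n) = N.
Proof. by rewrite /N /=; lia. Qed.

Definition tab_word T := [seq N - entry T c.1 c.2 | c <- three_rows_cells n].

Lemma perm_cell_pos_codom :
  perm_eq (codom (@cell_pos (three_rows n))) (three_rows_cells n).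
Proof.
apply: perm_codom; [exact: cell_pos_inj|exact: three_rows_cells_uniq|].
move=> [i j]; rewrite mem_three_rows_cells; split.
  move=> /andP[i3 ij]; have [c [ci cj]] := (three_rows_posP n i j).2 (conj i3 ij).
  by exists c; rewrite -ci -cj.
by case=> c [<- <-]; apply/andP/three_rows_posP; exists c.
Qed.

Lemma card_three_rows : #|cell (three_rows n)| = sumn (three_rows n).
Proof.
rewrite sumn_three_rows -(size_codom (@cell_pos _)) (perm_size perm_cell_pos_codom).
exact: size_three_rows_cells.
Qed.

Lemma tab_word_codom T : perm_eq (tab_word T) (codom (fun c => N - (T c).+1)).
Proof.
rewrite perm_sym; have := perm_map (fun c => N - entry T c.1 c.2) perm_cell_pos_codom.
by rewrite -map_comp; under eq_map do rewrite /= entry_cell.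
Qed.

Lemma filling_lt T c : T c < N.
Proof. by rewrite -sumn_three_rows. Qed.

Lemma perm_tab_word T :
  perm_eq (tab_word T) (iota 0 N) = [forall k, #|[set c | T c == k]| == 1].
Proof.
rewrite (permPl (tab_word_codom T)) perm_iotaE size_codom.
rewrite (etrans card_three_rows sumn_three_rows) eqxx /=.
have -> : all (gtn N) (codom (fun c => N - (T c).+1)).
  by apply/allP => _ /codomP[c ->] /=; rewrite /N; lia.
rewrite andbT.
have fibersP := @injective_card_fibers _ _ T (etrans card_three_rows (esym (card_ord _))).
apply/injectiveP/idP => [inj_letter|/fibersP T_inj c d Ecd].
  by apply/fibersP => c d Ecd; apply: inj_letter; rewrite Ecd.
have {}Ecd : N - (T c).+1 = N - (T d).+1 := Ecd.
by apply/T_inj/ord_inj; have := filling_lt T c; have := filling_lt T d; lia.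
Qed.

Lemma tab_word_inj : injective tab_word.
Proof.
move=> T T' /eq_in_map E; apply/ffunP => c; apply: ord_inj.
have c_in : cell_pos c \in three_rows_cells n.
  by rewrite -(perm_mem perm_cell_pos_codom) codom_f.
have : N - entry T (cell_row c) (cell_col c) = N - entry T' (cell_row c) (cell_col c).
  exact: E _ c_in.
by rewrite !entry_cell; have := filling_lt T c; have := filling_lt T' c; lia.
Qed.

Lemma tab_word_surj w : perm_eq w (iota 0 N) -> exists T, tab_word T = w.
Proof.
move=> pw.
pose letter_at (c : cell (three_rows n)) := nth 0 w (index (cell_pos c) (three_rows_cells n)).
have filling_ord c : N.-1 - letter_at c < sumn (three_rows n).
  by rewrite sumn_three_rows /N; lia.
exists [ffun c => Ordinal (filling_ord c)].
have size_w : size w = size (three_rows_cells n).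
  by rewrite (perm_size pw) size_iota size_three_rows_cells.
apply: (@eq_from_nth _ 0); rewrite size_map // => k kN.
rewrite (nth_map (0, 0)) //; set x := nth _ _ k.
have /codomP[c xE] : x \in codom (@cell_pos (three_rows n)).
  by rewrite (perm_mem perm_cell_pos_codom) mem_nth.
rewrite xE entry_cell ffunE /= /letter_at -xE index_uniq ?three_rows_cells_uniq //.
have := @perm_iota_nth N w k pw; rewrite size_three_rows_cells in kN.
by rewrite /N in kN *; lia.
Qed.

Lemma entry_rows_lt T :
  [forall c, forall d,
     (cell_row c == cell_row d) && (cell_col c < cell_col d) ==> (T c < T d)] <->
  (forall i j, 0 < i <= 3 -> i <= j < n.+2 -> entry T i j < entry T i j.+1).
Proof.
split=> [/forallP rowT i j i3 ij|entry_lt].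
  have [|c [ci cj]] := (three_rows_posP n i j).2; first by split=> //; lia.
  have [|d [di dj]] := (three_rows_posP n i j.+1).2; first by split=> //; lia.
  rewrite -{1}ci -{1}cj -di -dj !entry_cell ltnS.
  by have /forallP/(_ d) := rowT c; rewrite ci di cj dj eqxx ltnSn.
apply/forallP => c; apply/forallP => d; apply/implyP => /andP[/eqP row_cd col_cd].
have [c3 cn] := (three_rows_posP n _ _).1 (ex_intro _ c (conj erefl erefl)).
have [_ dn] := (three_rows_posP n _ _).1 (ex_intro _ d (conj erefl erefl)).
rewrite -ltnS -!entry_cell -row_cd.
apply: (@ltn_homo_interval (entry T (cell_row c)) (cell_row c) n.+2) => [j||]; [|lia|lia].
by apply: entry_lt.
Qed.

Lemma entry_columns_lt T :
  [forall c, forall d,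
     (cell_col c == cell_col d) && (cell_row c < cell_row d) ==> (T c < T d)] <->
  (forall i j, 0 < i < 3 -> i < j <= n.+2 -> entry T i j < entry T i.+1 j).
Proof.
split=> [/forallP colT i j i3 ij|entry_lt].
  have [|c [ci cj]] := (three_rows_posP n i j).2; first by split=> //; lia.
  have [|d [di dj]] := (three_rows_posP n i.+1 j).2; first by split=> //; lia.
  rewrite -{1}ci -{1}cj -di -dj !entry_cell ltnS.
  by have /forallP/(_ d) := colT c; rewrite ci di cj dj eqxx ltnSn.
apply/forallP => c; apply/forallP => d; apply/implyP => /andP[/eqP col_cd row_cd].
have [c3 cn] := (three_rows_posP n _ _).1 (ex_intro _ c (conj erefl erefl)).
have [d3 dn] := (three_rows_posP n _ _).1 (ex_intro _ d (conj erefl erefl)).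
rewrite -ltnS -!entry_cell -col_cd.
apply: (@ltn_homo_interval (entry T ^~ (cell_col c)) 1 (minn 3 (cell_col c))) => [i||]; [|lia|lia].
by move=> i3; apply: entry_lt; lia.
Qed.

Lemma mem_ShSYT T : (T \in ShSYT (three_rows n)) = (tab_word T \in tab_words N).
Proof.
rewrite inE mem_tab_words perm_tab_word andbC /shifted_standard; congr (_ && _).
have entry_N i j : entry T i j <= N by rewrite -sumn_three_rows entry_le.
have wordP := standard_word_three_rows_cells n (fun i j => N - entry T i j).
apply/andP/idP => [[/entry_rows_lt row /entry_columns_lt col]|].
  apply/wordP; split=> i j i3 ij.
    by have := row i j i3 ij; have := entry_N i j.+1; lia.
  by have := col i j i3 ij; have := entry_N i.+1 j; lia.
case/wordP=> row col; split; [apply/entry_rows_lt|apply/entry_columns_lt] => i j i3 ij.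
  by have := row i j i3 ij; have := entry_N i j; lia.
by have := col i j i3 ij; have := entry_N i j; lia.
Qed.

Lemma perm_codom_tab_words : perm_eq
  (codom (fun T : {T | T \in ShSYT (three_rows n)} => tab_word (val T))) (tab_words N).
Proof.
apply: perm_codom => [T T' /tab_word_inj/val_inj //||w]; first exact: tab_words_uniq.
split=> [w_tab|[[T T_st] <-]]; last by rewrite -mem_ShSYT.
have /tab_word_surj[T Ew] : perm_eq w (iota 0 N).
  by move: w_tab; rewrite mem_tab_words => /andP[].
have T_st : T \in ShSYT (three_rows n) by rewrite mem_ShSYT Ew.
by exists (exist _ T T_st).
Qed.

Lemma entry_first_row_last T : entry T 1 n.+2 = N - nth 0 (tab_word T) 0.
Proof.
have first_cell : nth (0, 0) (three_rows_cells n) 0 = (1, n.+2) by case: (n).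
rewrite (nth_map (0, 0)) ?size_three_rows_cells // first_cell.
by rewrite subKn // -sumn_three_rows entry_le.
Qed.

End TableauWord.

Theorem theorem2p9 (n : nat) (hn : 1 <= n) :
  exists f : { p : 'S_(2 * n - 1) | p \in DU_4123 (2 * n - 1)} ->
             {T : filling [:: n.+1; n; n - 1] | T \in ShSYT [:: n.+1; n; n - 1]},
    bijective f /\
    forall p : { p : 'S_(2 * n - 1) | p \in DU_4123 (2 * n - 1)},
      entry (val (f p)) 1 n.+1 = 3 * n - letter (val p) 1.
Proof.
case: n hn => // n _.
have size_du : 2 * n.+1 - 1 = n.*2.+1 by lia.
have third_row : n.+1 - 1 = n by lia.
rewrite {}size_du {}third_row.
have stat_eq : perm_eq
    (codom (fun p : {p | p \in DU_4123 n.*2.+1} => du_stat (perm_word (val p))))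
    (codom (fun T : {T | T \in ShSYT (three_rows n)} => tab_stat (tab_word (val T)))).
  rewrite [X in perm_eq X _](map_comp du_stat) [X in perm_eq _ X](map_comp tab_stat).
  rewrite (permPl (perm_map _ (perm_codom_du_words _))).
  rewrite (permPr (perm_map _ (perm_codom_tab_words _))).
  exact: perm_du_tab_stat.
have [f [bij_f f_stat]] := bij_of_perm_codom stat_eq.
exists f; split=> // p; rewrite entry_first_row_last letter1E //.
by have [-> _] := f_stat p; rewrite mulnS.
Qed.
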